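(* For every $\varepsilon>0$ there is an equivalent norm on dyadic Hardy space $H_1$ such that, with respect to it, the Haar system is normalized, $1$-unconditional and $(1+\varepsilon)$-greedy; and for every $\varepsilon>0$ there is an equivalent norm on Tsirelson's space $T$ such that, with respect to it, the unit vector basis is normalized, $1$-unconditional and $(1+\varepsilon)$-greedy.
   Context: Spaces are real and $\mathbb N=\{1,2,\dots\}$. Dyadic Hardy space $H_1=H_1(\mathbb R)$: for a dyadic interval $I\subset\mathbb R$ with left and right halves $I^-$, $I^+$ let $h_I=|I|^{-1}(\mathbf 1_{I^-}-\mathbf 1_{I^+})$ (the $L_1$-normalized Haar function). $H_1$ is the completion of the linear span of the $h_I$ in the norm $\|\sum_I a_Ih_I\|=\int_{\mathbb R}\big(\sum_I a_I^2h_I^2\big)^{1/2}\,dx$. The Haar system is $(h_I)$, with the dyadic intervals enumerated by $\mathbb N$. Tsirelson's space $T$ (Figiel–Johnson description): the completion of the space $c_{00}$ of finitely supported real sequences in the unique norm satisfying $\|x\|=\max\{\|x\|_{\infty},\ \tfrac12\sup\sum_{i=1}^n\|E_ix\|\}$, where the supremum is over all $n\in\mathbb N$ and finite sets $E_1<E_2<\cdots<E_n$ of $\mathbb N$ with $n\le\min E_1$, $E<F$ means $\max E<\min F$, and $Ex$ is the restriction of $x$ to $E$. The unit vector basis is the image of the standard basis of $c_{00}$. For a basis $(e_i)_{i\in\mathbb N}$ of a Banach space $X$: normalized means $\|e_i\|=1$ for all $i$; $K$-unconditional means $\|\sum a_ie_i\|\le K\|\sum b_ie_i\|$ whenever $|a_i|\le|b_i|$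 for all $i$. For $x=\sum x_ie_i$ and $m\in\mathbb N$ put $\sigma_m(x)=\inf\{\|x-\sum_{i\in A}a_ie_i\|: A\subset\mathbb N,\ |A|\le m,\ (a_i)_{i\in A}\subset\mathbb R\}$. For each $x$ fix distinct indices $\rho(1),\rho(2),\dots$ (depending on $x$, not necessarily unique) such that $|x_{\rho(1)}|\ge|x_{\rho(2)}|\ge\cdots$ and, for every $m$, $|x_{\rho(m)}|\ge|x_i|$ for all $i\notin\{\rho(1),\dots,\rho(m)\}$; put $\mathcal G_m(x)=\sum_{i=1}^m x_{\rho(i)}e_{\rho(i)}$. $C$-greedy means $\|x-\mathcal G_m(x)\|\le C\sigma_m(x)$ for all $x\in X$, $m\in\mathbb N$. *)

(* Defs.v *)
From HB Require Import structures.
From mathcomp Require Export all_boot all_order all_algebra.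
From mathcomp Require Export finmap.
From mathcomp Require Export all_classical all_reals all_analysis.

Set Implicit Arguments.
Unset Strict Implicit.
Unset Printing Implicit Defensive.

Export Order.TTheory GRing.Theory Num.Theory.
Export numFieldNormedType.Exports.

Local Open Scope classical_set_scope.
Local Open Scope ring_scope.

(** * Norms, equivalent norms, completions *)

Definition is_norm_on (R : realType) (V : lmodType R) (S : set V)
    (N : V -> R) : Prop :=
  [/\ forall u v, S u -> S v -> N (u + v) <= N u + N v,
      forall (a : R) u, S u -> N (a *: u) = `|a| * N u
    & forall u, S u -> N u = 0 -> u = 0].

Definition equivalent_norm (R : realType) (X : normedModType R)
    (N : X -> R) : Prop :=
  is_norm_on [set: X] N /\
  exists c C : R, [/\ 0 < c, 0 < C
    & forall x : X, c * `|x| <= N x /\ N x <= C * `|x|].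

(** The Banach space [X], with the embedding [j], is the completion of the
    linear subspace [S] of [V] under the norm [N].  The values of [N] and [j]
    outside [S] are irrelevant. *)
Definition is_completion (R : realType) (V : lmodType R) (S : set V)
    (N : V -> R) (X : completeNormedModType R) (j : V -> X) : Prop :=
  [/\ forall (a : R) u v, S u -> S v -> j (a *: u + v) = a *: j u + j v,
      forall u, S u -> `|j u| = N u
    & closure (j @` S) = [set: X]].

(** * Bases and greedy approximation

    Sequences are indexed from [0]: [e i] is the basis vector number [i + 1]. *)

Definition expands (R : realType) (X : normedModType R) (e : nat -> X)
    (a : nat -> R) (x : X) : Prop :=
  series (fun i => a i *: e i) @ \oo --> x.

Definition schauder_basis (R : realType) (X : normedModType R)
    (e : nat -> X) : Prop :=
  forall x : X, exists! a : nat -> R, expands e a x.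

Definition normalized_for (R : realType) (X : normedModType R) (N : X -> R)
    (e : nat -> X) : Prop :=
  forall i, N (e i) = 1.

Definition unconditional_for (R : realType) (X : normedModType R) (N : X -> R)
    (K : R) (e : nat -> X) : Prop :=
  forall (a b : nat -> R) (y : X),
    (forall i, `|a i| <= `|b i|) -> expands e b y ->
    exists2 x : X, expands e a x & N x <= K * N y.

Definition sigma_for (R : realType) (X : normedModType R) (N : X -> R)
    (e : nat -> X) (m : nat) (x : X) : R :=
  inf [set r | exists (A : {fset nat}) (a : nat -> R),
        (#|` A| <= m)%N /\ r = N (x - \sum_(i <- A) a i *: e i)].

(** [rho k] is the index written rho(k+1) when counting from 1. *)
Definition greedy_ordering (R : realType) (x : nat -> R) (rho : nat -> nat)
    : Prop :=
  [/\ injective rho,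
      forall k, `|x (rho k.+1)| <= `|x (rho k)|
    & forall m i, (forall k, (k <= m)%N -> i <> rho k) ->
        `|x i| <= `|x (rho m)|].

Definition greedy_sum (R : realType) (X : normedModType R) (e : nat -> X)
    (a : nat -> R) (rho : nat -> nat) (m : nat) : X :=
  \sum_(k < m) a (rho k) *: e (rho k).

(** The estimate is required for every admissible choice of [rho]. *)
Definition greedy_for (R : realType) (X : normedModType R) (N : X -> R)
    (C : R) (e : nat -> X) : Prop :=
  forall (x : X) (a : nat -> R) (rho : nat -> nat) (m : nat),
    expands e a x -> greedy_ordering a rho -> (0 < m)%N ->
    N (x - greedy_sum e a rho m) <= C * sigma_for N e m x.

(** * Dyadic Hardy space *)

(** The pair [(n, k)] of integers encodes the interval
    [k 2^n, (k + 1) 2^n); this is one-to-one onto the dyadic intervals. *)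
Definition dyadic (R : realType) (I : int * int) : set R :=
  [set x | I.2%:~R * 2 ^ I.1 <= x < (I.2 + 1)%:~R * 2 ^ I.1].
Arguments dyadic : clear implicits.

Definition left_half (I : int * int) : int * int :=
  (I.1 - 1, 2 * I.2).

Definition right_half (I : int * int) : int * int :=
  (I.1 - 1, 2 * I.2 + 1).

Definition haar (R : realType) (I : int * int) : R -> R :=
  fun x => (2 ^ I.1)^-1 *
    (\1_(dyadic R (left_half I)) x - \1_(dyadic R (right_half I)) x).
Arguments haar : clear implicits.

Definition haar_sum (R : realType) (F : {fset int * int})
    (a : int * int -> R) : R -> R :=
  fun x => \sum_(I <- F) a I * haar R I x.

Definition haar_span (R : realType) : set (R -> R) :=
  [set f | exists (F : {fset int * int}) (a : int * int -> R),
     f = haar_sum F a].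
Arguments haar_span : clear implicits.

Definition is_hardy_norm (R : realType) (N : (R -> R) -> R) : Prop :=
  forall (F : {fset int * int}) (a : int * int -> R),
    (N (haar_sum F a))%:E =
    (\int[lebesgue_measure]_x
       (Num.sqrt (\sum_(I <- F) a I ^+ 2 * haar R I x ^+ 2))%:E)%E.

(** * Tsirelson's space *)

Definition c00 (R : realType) : set (nat -> R) :=
  [set x | finite_set [set i | x i != 0]].
Arguments c00 : clear implicits.

Definition unit_vector (R : realType) (i : nat) : nat -> R :=
  fun k => (k == i)%:R.
Arguments unit_vector : clear implicits.

Definition restriction (R : realType) (E : set nat) (x : nat -> R)
    : nat -> R :=
  fun i => if i \in E then x i else 0.

Definition set_before (E F : set nat) : Prop :=
  forall i k, E i -> F k -> (i < k)%N.

(** [E 0 < ... < E (n-1)] are finite nonempty sets with [n <= min (E 0)];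
    since coordinates are counted from [0], the coordinate [i] is the positive
    integer [i.+1] in the condition on the minimum. *)
Definition admissible (n : nat) (E : nat -> set nat) : Prop :=
  [/\ (0 < n)%N,
      forall i, (i < n)%N -> finite_set (E i) /\ E i !=set0,
      forall i, (i.+1 < n)%N -> set_before (E i) (E i.+1)
    & forall i, E 0%N i -> (n <= i.+1)%N].

(** The suprema are taken in the extended reals, so that the equation forces
    them to be finite. *)
Definition is_tsirelson_norm (R : realType) (N : (nat -> R) -> R) : Prop :=
  is_norm_on (c00 R) N /\
  forall x, c00 R x ->
    (N x)%:E =
    maxe (ereal_sup [set (`|x i|)%:E | i in [set: nat]])
         ((2^-1)%:E *
          ereal_sup [set r : \bar R | exists n (E : nat -> set nat),
            admissible n E /\
            r = (\sum_(i < n) N (restriction (E i) x))%:E])%E.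

(* Main.v *)
Require Import Defs.
From mathcomp Require Import all_boot all_order all_algebra finmap.
From mathcomp Require Import all_classical all_reals all_analysis.
From mathcomp Require Import measurable_realfun.
From mathcomp Require Import zify ring lra.

(** Both bases have the property that half of every finite set [B] of basis
    vectors spans a copy of a finite-dimensional l1, with a constant that does
    not depend on [B] ([tsirelson_halves], [hardy_halves]).  The renorming uses
    nothing else about the spaces, apart from 1-unconditionality
    ([greedy_renorming]).

    Iterating the halving, for every [mu < 1] there is a constant [C] such that
    every finite set [B] contains a set [B'] with at least [mu * #|B|] elements
    whose indicator is a functional of norm at most [C]
    ([l1_bounded_most]).  Let [q < 1], and let the new norm of [x] be the
    supremum, over all [j] and all finite sets [D] whose indicator has norm at
    most [j * C], of
      [q ^ j * (norm of x off D + l1 norm of x on D)].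
    It is equivalent to the given norm because [q ^ j * (1 + j * C)] is bounded
    in [j], and it keeps the basis normalized and 1-unconditional.

    Let [x] be approximated on the set [G] of [m] coordinates picked by the
    greedy algorithm, and in any other way on a set [A] of [m] coordinates; let
    [y] be [x] off [A] and [G], let [t] be the smallest of the entries of [x] on
    [G], and let [B] be [G] without [A].  In the seminorm given by [j, D] the
    greedy remainder exceeds [y] by at most [q ^ j * t * #|B|], since it has
    no more than [#|B|] further entries, none above [t].  Replacing [D] by the
    union of [D] and [B'] turns [j] into [j + 1], which is allowed since norms
    of indicators add.  Up to the factor [q ^ (j + 1)], the other remainder
    exceeds [y] in this seminorm by [t * #|B'| >= mu * t * #|B|] or more.  So the
    basis is greedy with constant [(q * mu)^-1], which can be any number
    larger than 1 ([greedy_greedy_norm]).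

    In Tsirelson's space the upper half of [B] is admissible when cut into
    singletons.  In Hardy space, the intervals of [B] one half of which contains
    no member of [B] are at least half of all ([card_half_free]).
    Such empty halves are disjoint, so on them the square function dominates
    each single term of the sum. *)

Import Order.TTheory GRing.Theory Num.Theory.

Set Implicit Arguments.
Unset Strict Implicit.
Unset Printing Implicit Defensive.

Local Open Scope classical_set_scope.
Local Open Scope ring_scope.

(** * Finitely unconditional sequences with dense span *)

(** 1-unconditionality stated on finite sums only, which makes sense before
    [e] is known to be a basis. *)
Definition finitely_unconditional (R : realType) (X : normedModType R)
    (e : nat -> X) : Prop :=
  forall (r : seq nat) (a b : nat -> R), uniq r ->
    (forall i, `|a i| <= `|b i|) ->
    `|\sum_(i <- r) a i *: e i| <= `|\sum_(i <- r) b i *: e i|.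

Definition finite_sums_dense (R : realType) (X : normedModType R)
    (e : nat -> X) : Prop :=
  forall (x : X) (d : R), 0 < d ->
    exists (r : seq nat) (a : nat -> R),
      uniq r /\ `|x - \sum_(i <- r) a i *: e i| < d.

Lemma sum_widen (R : realType) (X : lmodType R) (e : nat -> X)
    (r s : seq nat) (a : nat -> R) :
  uniq r -> uniq s -> {subset r <= s} ->
  \sum_(i <- r) a i *: e i = \sum_(i <- s) (if i \in r then a i else 0) *: e i.
Proof.
move=> ur us rs.
rewrite [RHS](eq_bigr (fun i => if i \in r then a i *: e i else 0)); last first.
  by move=> i _; case: ifP => // _; rewrite scale0r.
rewrite -big_mkcond -[RHS]big_filter; apply: perm_big.
apply: uniq_perm => //; first exact: filter_uniq.
move=> i; rewrite mem_filter; case: (boolP (i \in r)) => //= ir.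
by rewrite rs.
Qed.

Section FinitelyUnconditional.
Context (R : realType) (X : completeNormedModType R) (e : nat -> X).
Context (e1 : forall i, `|e i| = 1) (eU : finitely_unconditional e).

Lemma sum_le_sub (r s : seq nat) (a b : nat -> R) :
  uniq r -> uniq s -> {subset r <= s} ->
  (forall i, i \in r -> `|a i| <= `|b i|) ->
  `|\sum_(i <- r) a i *: e i| <= `|\sum_(i <- s) b i *: e i|.
Proof.
move=> ur us rs ab; rewrite (sum_widen _ _ ur us rs); apply: eU => // i.
by case: ifP => [/ab//|_]; rewrite normr0.
Qed.

Lemma coordinate_le (r : seq nat) (a : nat -> R) i :
  uniq r -> i \in r -> `|a i| <= `|\sum_(k <- r) a k *: e k|.
Proof.
move=> ur ir.
have := @sum_le_sub [:: i] r a a isT ur.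
rewrite big_seq1 normrZ e1 mulr1; apply=> // k; rewrite inE => /eqP->//.
Qed.

Lemma expands_unique (a b : nat -> R) (x : X) :
  expands e a x -> expands e b x -> a = b.
Proof.
rewrite /expands => ax bx; apply/funext => i; apply/eqP.
rewrite -subr_eq0 -normr_le0.
have h0 : `|series (fun i => a i *: e i) n - series (fun i => b i *: e i) n|
    @[n --> \oo] --> `|x - x| by apply: cvg_norm; exact: cvgB.
rewrite subrr normr0 in h0; apply: (cvgr_to_ge h0).
exists i.+1 => // n /= i_n.
have -> : series (fun i => a i *: e i) n - series (fun i => b i *: e i) n
    = \sum_(k <- index_iota 0 n) (a k - b k) *: e k.
  rewrite /series /= -sumrB; apply: eq_bigr => k _; by rewrite scalerBl.
apply: (@coordinate_le _ (fun k => a k - b k)); first exact: iota_uniq.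
by rewrite mem_index_iota.
Qed.

(** The coefficients of [x] are the limits of the coefficients of finite sums
    [y k] tending to [x]: these are Cauchy because a coefficient is dominated by
    the norm.  The resulting series converges to [x] because truncation is a
    contraction, so that truncating [y l - y k] costs nothing, uniformly in the
    length of the truncation; let [l] tend to infinity. *)
Lemma expands_exists : finite_sums_dense e -> forall x, exists a, expands e a x.
Proof.
move=> dense x.
(* Zero coefficients are added so that the sums become initial segments. *)
have dense_iota d : 0 < d -> exists n (b : nat -> R),
    forall m, (n <= m)%N -> `|x - \sum_(i <- index_iota 0 m) b i *: e i| < d.
  move=> d0; have [r [a [ur xd]]] := dense x d d0.
  exists (\max_(i <- r) i).+1, (fun i => if i \in r then a i else 0) => m nm.
  rewrite -sum_widen //; first exact: iota_uniq.
  move=> i ir; rewrite mem_index_iota /=; apply: leq_trans nm.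
  by rewrite ltnS; apply: leq_bigmax_seq.
have pos (k : nat) : 0 < k.+1%:R^-1 :> R by rewrite invr_gt0.
have [n /choice[b bP]] := choice (fun k => dense_iota _ (pos k)).
have small d : 0 < d -> exists k,
    (forall m, (n k <= m)%N ->
       `|x - \sum_(i <- index_iota 0 m) b k i *: e i| < d) /\
    forall l, (k <= l)%N -> forall m, (n k <= m)%N -> (n l <= m)%N ->
      `|\sum_(i <- index_iota 0 m) (b k i - b l i) *: e i| < d.
  move=> d0; have d20 : 0 < d / 2 by rewrite divr_gt0.
  have [k kd] : exists k : nat, k.+1%:R^-1 < d / 2.
    have [k _ /(_ k (leqnn _)) /= kd] := near_infty_natSinv_lt (PosNum d20).
    by exists k.
  exists k; split => [m km|l kl m km lm].
    apply: lt_trans (bP k m km) _; apply: lt_trans kd _.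
    by rewrite ltr_pdivrMr// mulr2n mulrDr mulr1 ltrDl.
  under eq_bigr do rewrite scalerBl.
  rewrite sumrB -(subrKA x) addrC.
  apply: le_lt_trans (ler_normD _ _) _.
  rewrite [ltRHS]splitr ltrD //; last first.
    by rewrite distrC; apply: lt_trans kd; apply: bP.
  apply: lt_trans (bP l m lm) _; apply: le_lt_trans kd.
  by rewrite lef_pV2 ?posrE ?ltr0n// ler_nat.
have cvg_b i : cvg ((fun k => b k i) @ \oo).
  apply/cauchy_cvgP/cauchy_exP => d d0.
  have [k [_ kP]] := small d d0.
  exists (b k i); exists k => // l /= kl.
  pose m := maxn i.+1 (maxn (n k) (n l)).
  apply: (le_lt_trans _ (kP l kl m _ _)); rewrite ?/m ?leq_max ?leqnn ?orbT//.
  apply: (@coordinate_le _ (fun i => b k i - b l i)); first exact: iota_uniq.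
  by rewrite mem_index_iota /= leq_max leqnn.
pose a i := lim ((fun k => b k i) @ \oo); exists a.
apply/cvgrPdist_le => d d0.
have d20 : 0 < d / 2 by rewrite divr_gt0.
have [k [xk kP]] := small _ d20.
exists (n k) => // m /= km.
rewrite /series /= -/(index_iota 0 m).
have close : `|\sum_(i <- index_iota 0 m) (b k i - a i) *: e i| <= d / 2.
  have lim_l : \sum_(i <- index_iota 0 m) (b k i - b l i) *: e i @[l --> \oo] -->
      \sum_(i <- index_iota 0 m) (b k i - a i) *: e i.
    apply: cvg_big => [|i _]; first exact: add_continuous.
    by apply: cvgZl; apply: cvgB; [exact: cvg_cst|exact: cvg_b].
  apply: (cvgr_to_le (cvg_norm lim_l)).
  exists k => // l /= kl.
  pose M := maxn m (n l).
  apply: le_trans (ltW (kP l kl M _ _)); last by rewrite leq_maxr.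
    apply: (@sum_le_sub _ _ (fun i => b k i - b l i)); rewrite ?iota_uniq// => i.
    by rewrite !mem_index_iota /= leq_max => ->.
  by rewrite (leq_trans km)// leq_maxl.
rewrite -(subrKA (\sum_(i <- index_iota 0 m) b k i *: e i)).
apply: le_trans (ler_normD _ _) _.
rewrite [leRHS]splitr lerD //; first exact: ltW (xk _ km).
by rewrite -sumrB; under eq_bigr do rewrite -scalerBl.
Qed.

Lemma expands_dominated (a b : nat -> R) (y : X) :
  (forall i, `|a i| <= `|b i|) -> expands e b y -> exists x, expands e a x.
Proof.
move=> ab /cvgrPdist_lt by_; apply/cvg_ex/cauchy_cvgP/cauchy_exP => d d0.
have d20 : 0 < d / 2 by rewrite divr_gt0.
have [k _ kP] := by_ _ d20.
exists (series (fun i => a i *: e i) k); exists k => // l /= kl.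
rewrite -ball_normE /= distrC sub_series_geq//.
apply: (@le_lt_trans _ _ `|\sum_(k <= i < l) b i *: e i|).
  by apply: eU => //; exact: iota_uniq.
rewrite -sub_series_geq// -(subrKA y).
apply: le_lt_trans (ler_normD _ _) _.
rewrite [ltRHS]splitr ltrD //; first by rewrite distrC; exact: kP.
by apply: kP => /=.
Qed.

Lemma expands_norm_le (a b : nat -> R) (x y : X) :
  (forall i, `|a i| <= `|b i|) -> expands e a x -> expands e b y ->
  `|x| <= `|y|.
Proof.
move=> ab ax by_; apply: (ler_cvg_to (cvg_norm ax) (cvg_norm by_)).
by near=> n; apply: eU => //; exact: iota_uniq.
Unshelve. all: by end_near. Qed.

Lemma expands_sum (r : seq nat) (a : nat -> R) : uniq r ->
  expands e (fun i => if i \in r then a i else 0) (\sum_(i <- r) a i *: e i).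
Proof.
move=> ur; apply: cvg_near_cst; exists (\max_(i <- r) i).+1 => // n /= rn.
rewrite /series /= -sum_widen //; first exact: iota_uniq.
move=> i ir; rewrite mem_index_iota /=; apply: leq_trans rn.
by rewrite ltnS; apply: leq_bigmax_seq.
Qed.

Lemma schauder_basis_of_dense : finite_sums_dense e -> schauder_basis e.
Proof.
move=> dense x; have [a ax] := expands_exists dense x.
by exists a; split => // b; exact: expands_unique.
Qed.
End FinitelyUnconditional.

(** * The renorming *)

Lemma sumr_fset_sub (R : numDomainType) (K : choiceType) (A B : {fset K})
    (f : K -> R) :
  (A `<=` B)%fset -> (forall i, 0 <= f i) ->
  \sum_(i <- A) f i <= \sum_(i <- B) f i.
Proof.
move=> /fsubsetP AB f0.
rewrite (big_fsetID _ (mem A) B) /= -[leLHS]addr0 lerD //; last exact: sumr_ge0.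
rewrite le_eqVlt; apply/orP; left; apply/eqP/perm_big/uniq_perm; rewrite ?fset_uniq//.
move=> i; rewrite !inE /=; case: (boolP (i \in A)) => [iA|]; last by rewrite andbF.
by rewrite AB.
Qed.

Lemma sumr_fsetU_le (R : numDomainType) (K : choiceType) (A B : {fset K})
    (f : K -> R) :
  (forall i, 0 <= f i) ->
  \sum_(i <- (A `|` B)%fset) f i <= \sum_(i <- A) f i + \sum_(i <- B) f i.
Proof.
move=> f0; rewrite (big_fsetID _ (mem A) (A `|` B)%fset) /=.
apply: lerD; apply: sumr_fset_sub => //; apply/fsubsetP => i; rewrite !inE /=.
  by case/andP.
by case/andP => /orP[->|].
Qed.

(** Half of every finite part of the basis spans, with constant [C], a copy of
    a finite-dimensional l1.  This is what is used of the fact that sums of [n]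
    basis vectors have norm of order [n]. *)
Definition halves_l1 (R : realType) (X : normedModType R) (e : nat -> X)
    (C : R) : Prop :=
  forall B : {fset nat}, exists B' : {fset nat},
    [/\ (B' `<=` B)%fset, (#|` B| <= 2 * #|` B'|)%N &
        forall a : nat -> R,
          \sum_(i <- B') `|a i| <= C * `|\sum_(i <- B') a i *: e i|].

Section Renorming.
Context (R : realType) (X : completeNormedModType R) (e : nat -> X).
Context (e1 : forall i, `|e i| = 1) (eU : finitely_unconditional e).
Context (coef : X -> nat -> R) (coefP : forall x, expands e (coef x) x).

Let coefficientE a x : expands e a x -> coef x = a.
Proof. exact: (expands_unique e1 eU (@coefP x)). Qed.

Lemma coefficientD x y i : coef (x + y) i = coef x i + coef y i.
Proof.
rewrite (@coefficientE (fun i => coef x i + coef y i) (x + y))//.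
rewrite /expands (_ : series _ = (fun n => series (fun i => coef x i *: e i) n +
  series (fun i => coef y i *: e i) n)); first by apply: cvgD; exact: coefP.
apply/funext => n; rewrite /series /= -big_split /=.
by apply: eq_bigr => k _; rewrite scalerDl.
Qed.

Lemma coefficientZ c x i : coef (c *: x) i = c * coef x i.
Proof.
rewrite (@coefficientE (fun i => c * coef x i) (c *: x))//.
rewrite /expands (_ : series _ =
  (fun n => c *: series (fun i => coef x i *: e i) n)).
  by apply: cvgZr; exact: coefP.
apply/funext => n; rewrite /series /= scaler_sumr.
by apply: eq_bigr => k _; rewrite scalerA.
Qed.

Lemma coefficientB x y i : coef (x - y) i = coef x i - coef y i.
Proof. by rewrite -scaleN1r coefficientD coefficientZ mulN1r. Qed.

Lemma coef_sum (r : seq nat) (a : nat -> R) i : uniq r ->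
  coef (\sum_(k <- r) a k *: e k) i = if i \in r then a i else 0.
Proof. by move=> ur; rewrite (coefficientE (@expands_sum _ _ e r a ur)). Qed.

Lemma coef_e i k : coef (e i) k = (k == i)%:R.
Proof.
have := @coef_sum [:: i] (fun=> 1) k isT; rewrite big_seq1 scale1r inE => ->.
by case: (k == i).
Qed.

Lemma coef_norm_le x y :
  (forall i, `|coef x i| <= `|coef y i|) -> `|x| <= `|y|.
Proof. by move=> xy; apply: (expands_norm_le eU xy). Qed.

Definition proj (D : {fset nat}) (x : X) : X := \sum_(i <- D) coef x i *: e i.

Lemma coef_proj D x i : coef (proj D x) i = if i \in D then coef x i else 0.
Proof. by rewrite /proj coef_sum ?fset_uniq. Qed.

Lemma coef_cproj D x i :
  coef (x - proj D x) i = if i \in D then 0 else coef x i.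
Proof. by rewrite coefficientB coef_proj; case: ifP; rewrite ?subrr ?subr0. Qed.

(** The indicator of [D], with arbitrary signs, is a functional of norm at most
    [c]. *)
Definition l1_bounded (c : R) (D : {fset nat}) : Prop :=
  forall x, \sum_(i <- D) `|coef x i| <= c * `|x|.

Lemma l1_boundedU c d A B : l1_bounded c A -> l1_bounded d B ->
  l1_bounded (c + d) (A `|` B)%fset.
Proof.
move=> cA dB x; rewrite mulrDl; apply: le_trans (sumr_fsetU_le _ _ _) _ => //.
exact: lerD.
Qed.

Lemma l1_bounded0 : l1_bounded 0 fset0.
Proof. by move=> x; rewrite big_seq_fset0 mul0r. Qed.

(** Taking half of what is left, [k] times, leaves a fraction [2 ^- k], and
    each step adds [C] to the norm of the indicator.  So indicators of bounded
    norm exhaust any finite set up to an arbitrarily small proportion. *)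
Lemma l1_bounded_most C k (B : {fset nat}) : 0 <= C -> halves_l1 e C ->
  exists B' : {fset nat},
    [/\ (B' `<=` B)%fset, (2 ^ k * #|` (B `\` B')%fset| <= #|` B|)%N
      & l1_bounded (k%:R * C) B'].
Proof.
move=> C0 half; elim: k => [|k [B1 [B1B cardB1 bB1]]].
  exists fset0; split; rewrite ?fsub0set ?fsetD0 ?mul1n//.
  by rewrite mul0r; exact: l1_bounded0.
have [B2 [B2B cardB2 bB2]] := half (B `\` B1)%fset.
exists (B1 `|` B2)%fset; split.
- rewrite fsubUset B1B /=; apply: fsubset_trans B2B _; exact: fsubsetDl.
- rewrite -fsetDDl cardfsDS//; apply: leq_trans cardB1.
  rewrite expnS -mulnA mulnCA leq_mul2l mulnBr; apply/orP; right.
  move: cardB2; lia.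
- rewrite -natr1 mulrDl mul1r; apply: l1_boundedU => // x.
  apply: le_trans (bB2 (coef x)) _; rewrite ler_wpM2l//.
  apply: coef_norm_le => i; rewrite coef_sum ?fset_uniq//; case: ifP => //.
  by rewrite normr0.
Qed.

Section Norm.
Context (C d : R) (C0 : 0 <= C) (d0 : 0 < d).

(** The norm is replaced by the l1 norm on [D]; this costs at most [j%:R * C]
    when the indicator of [D] has norm at most [j%:R * C], and the weight
    [(1 + d) ^- j] makes the total cost bounded in [j]. *)
Definition partial_l1 (j : nat) (D : {fset nat}) (x : X) : R :=
  (1 + d) ^- j * (`|x - proj D x| + \sum_(i <- D) `|coef x i|).

Definition greedy_norm (x : X) : R :=
  sup [set r | exists (j : nat) (D : {fset nat}),
         l1_bounded (j%:R * C) D /\ r = partial_l1 j D x].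

Let q0 j : 0 < (1 + d) ^- j.
Proof. by rewrite invr_gt0 exprn_gt0// addr_gt0. Qed.

Lemma bernoulli_inequality j : j%:R * d <= (1 + d) ^+ j.
Proof.
suff : 1 + j%:R * d <= (1 + d) ^+ j by apply: le_trans; rewrite lerDr.
elim: j => [|j IH]; first by rewrite mul0r addr0.
rewrite exprS; apply: le_trans (ler_wpM2l _ IH); last by rewrite ltW// addr_gt0.
rewrite -natr1; have : 0 <= j%:R * d * d by rewrite !mulr_ge0// ltW.
by set t := j%:R; lra.
Qed.

Lemma partial_l1_le j D x : l1_bounded (j%:R * C) D ->
  partial_l1 j D x <= (1 + C / d) * `|x|.
Proof.
move=> bD; rewrite /partial_l1 mulrC ler_pdivrMr ?exprn_gt0 ?addr_gt0//.
apply: (@le_trans _ _ (`|x| + j%:R * C * `|x|)).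
  apply: lerD => //; apply: coef_norm_le => i; rewrite coef_cproj.
  by case: ifP => //; rewrite normr0.
rewrite -[X in X + _]mul1r -mulrDl [leRHS]mulrAC ler_wpM2r// mulrDl mul1r lerD//.
  by rewrite exprn_ege1// lerDl ltW.
rewrite mulrC -mulrA ler_wpM2l// ler_pdivlMl// mulrC; exact: bernoulli_inequality.
Qed.

Lemma partial_l1_has_sup x :
  has_sup [set r | exists (j : nat) (D : {fset nat}),
         l1_bounded (j%:R * C) D /\ r = partial_l1 j D x].
Proof.
split.
  exists (partial_l1 0 fset0 x), 0%N, fset0; split => //.
  by rewrite mul0r; exact: l1_bounded0.
exists ((1 + C / d) * `|x|) => r [j [D [bD ->]]]; exact: partial_l1_le.
Qed.

Lemma greedy_norm_ub j D x : l1_bounded (j%:R * C) D ->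
  partial_l1 j D x <= greedy_norm x.
Proof.
move=> bD; apply: ub_le_sup; first by have [] := partial_l1_has_sup x.
by exists j, D.
Qed.

Lemma greedy_norm_le x M :
  (forall j D, l1_bounded (j%:R * C) D -> partial_l1 j D x <= M) ->
  greedy_norm x <= M.
Proof.
move=> xM; apply: ge_sup; first by have [] := partial_l1_has_sup x.
by move=> r [j [D [bD ->]]]; exact: xM.
Qed.

Lemma norm_le_greedy_norm x : `|x| <= greedy_norm x.
Proof.
have b0 : l1_bounded (0%:R * C) fset0 by rewrite mul0r; exact: l1_bounded0.
apply: le_trans (greedy_norm_ub x b0).
by rewrite /partial_l1 /proj !big_seq_fset0 expr0 invr1 mul1r subr0 addr0.
Qed.

Lemma partial_l1_mono j D x y : (forall i, `|coef x i| <= `|coef y i|) ->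
  partial_l1 j D x <= partial_l1 j D y.
Proof.
move=> xy; rewrite ler_pM2l//; apply: lerD; last exact: ler_sum.
by apply: coef_norm_le => i; rewrite !coef_cproj; case: ifP.
Qed.

Lemma partial_l1D j D x y :
  partial_l1 j D (x + y) <= partial_l1 j D x + partial_l1 j D y.
Proof.
rewrite -mulrDr ler_pM2l// addrACA; apply: lerD.
  apply: le_trans (ler_normD _ _); rewrite addrACA -opprD /proj -big_split /=.
  rewrite (eq_bigr (fun i => coef x i *: e i + coef y i *: e i)) // => i _.
  by rewrite coefficientD scalerDl.
rewrite -big_split /=; apply: ler_sum => i _; rewrite coefficientD; exact: ler_normD.
Qed.

Lemma partial_l1Z j D c x : partial_l1 j D (c *: x) = `|c| * partial_l1 j D x.
Proof.
rewrite /partial_l1 mulrCA; congr (_ * _); rewrite mulrDr; congr (_ + _).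
  rewrite -normrZ scalerBr /proj scaler_sumr; congr `|_ - _|.
  by apply: eq_bigr => i _; rewrite coefficientZ scalerA.
by rewrite mulr_sumr; apply: eq_bigr => i _; rewrite coefficientZ normrM.
Qed.

Lemma equivalent_greedy_norm : equivalent_norm greedy_norm.
Proof.
have Nle c x : greedy_norm (c *: x) <= `|c| * greedy_norm x.
  apply: greedy_norm_le => j D bD; rewrite partial_l1Z ler_wpM2l//.
  exact: greedy_norm_ub.
split; last first.
  exists 1, (1 + C / d); split=> //; first by rewrite ltr_pwDl// divr_ge0// ltW.
  move=> x; rewrite mul1r; split; first exact: norm_le_greedy_norm.
  apply: greedy_norm_le => j D; exact: partial_l1_le.
split=> [x y _ _|c x _|x _ x0].
- apply: greedy_norm_le => j D bD; apply: le_trans (partial_l1D _ _ _ _) _.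
  by apply: lerD; exact: greedy_norm_ub.
- apply/le_anti; rewrite Nle /=; have [->|c0] := eqVneq c 0.
    rewrite normr0 mul0r; apply: le_trans (norm_le_greedy_norm _); exact: normr_ge0.
  rewrite mulrC -ler_pdivlMr ?normr_gt0//.
  by rewrite -{1}[x]scale1r -(mulVf c0) -scalerA (le_trans (Nle _ _))// normfV mulrC.
- apply/eqP; rewrite -normr_le0 -x0; exact: norm_le_greedy_norm.
Qed.

Lemma partial_l1_e j D i : partial_l1 j D (e i) <= (1 + d) ^- j.
Proof.
rewrite -[leRHS]mulr1 ler_pM2l//.
under [X in _ + X]eq_bigr do rewrite coef_e.
have [iD|iD] := boolP (i \in D).
  rewrite (big_fsetD1 i)//= eqxx normr1 big1_fset ?addr0.
    have -> : proj D (e i) = e i; last by rewrite subrr normr0 add0r.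
    apply/eqP; rewrite -subr_eq0 -normr_le0 -(normr0 X); apply: coef_norm_le => k.
    rewrite coefficientB coef_proj coef_e; case: (eqVneq k i) => [->|].
      by rewrite iD subrr normr0.
    by rewrite if_same subrr normr0.
  by move=> k; rewrite !inE => /andP[/negPf-> _] _; rewrite normr0.
rewrite big1_fset ?addr0.
  rewrite -(e1 i); apply: coef_norm_le => k; rewrite coef_cproj.
  by case: ifP => //; rewrite normr0.
move=> k kD _; rewrite (_ : k == i = false) ?normr0//.
by apply: contraNF iD => /eqP<-.
Qed.

Lemma partial_l1_sum j D (r : seq nat) (a : nat -> R) :
  partial_l1 j D (\sum_(i <- r) a i *: e i) <=
  (1 + d) ^- j * \sum_(i <- r) `|a i|.
Proof.
elim: r => [|i r IH].
  by rewrite !big_nil mulr0 -(scale0r (0 : X)) partial_l1Z normr0 mul0r.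
rewrite !big_cons mulrDr; apply: le_trans (partial_l1D _ _ _ _) (lerD _ IH).
by rewrite partial_l1Z mulrC ler_wpM2r// partial_l1_e.
Qed.

Lemma normalized_greedy_norm : normalized_for greedy_norm e.
Proof.
move=> i; apply/le_anti; rewrite -{2}(e1 i) norm_le_greedy_norm andbT.
apply: greedy_norm_le => j D bD; apply: le_trans (partial_l1_e _ _ _) _.
by rewrite invf_le1 ?exprn_gt0 ?addr_gt0// exprn_ege1// lerDl ltW.
Qed.

Lemma unconditional_greedy_norm : unconditional_for greedy_norm 1 e.
Proof.
move=> a b y ab by_; have [x ax] := expands_dominated eU ab by_.
exists x => //; rewrite mul1r; apply: greedy_norm_le => j D bD.
apply: le_trans (greedy_norm_ub y bD); apply: partial_l1_mono => i.
by rewrite (coefficientE ax) (coefficientE by_).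
Qed.


(** The greedy remainder is [y + u] with [u] supported on [A `\` G], and the
    other remainder [z] dominates [y + v] with [v] supported on [G `\` A], where
    the entries of [u] are at most [t], those of [v] are at least [t], and
    [G `\` A] is the larger set.  Adding [u] raises the seminorm of [j, D] by
    at most [t] for each entry, since every basis vector has seminorm at most
    [(1 + d) ^- j].  Adding [v] raises the seminorm of [j.+1, D `|` B'] by
    [t] for each element of [B'], up to the weight [(1 + d) ^- j.+1]; and [B'],
    being disjoint from the support of [y], does not change what [D] gives on
    [y]. *)
Lemma greedy_greedy_norm (mu : R) : 0 < mu -> mu <= 1 ->
  (forall B : {fset nat}, exists B' : {fset nat},
    [/\ (B' `<=` B)%fset, mu * #|` B|%:R <= #|` B'|%:R & l1_bounded C B']) ->
  greedy_for greedy_norm ((1 + d) / mu) e.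
Proof.
move=> mu0 mu1 most x a rho m /coefficientE aE [rho_inj rho_dec rho_max] m0.
have K0 : 0 < (1 + d) / mu by rewrite divr_gt0// addr_gt0.
rewrite -ler_pdivrMl//; apply: lb_le_inf.
  by exists (greedy_norm (x - \sum_(i <- fset0) 0 *: e i)), fset0, (fun=> 0).
move=> _ [A [b [cardA ->]]]; rewrite ler_pdivrMl//.
set z := x - \sum_(i <- A) _.
pose G : {fset nat} := [fset rho k | k in iota 0 m]%fset.
have -> : greedy_sum e a rho m = proj G x.
  rewrite /greedy_sum /proj big_imfset/=; last by move=> k l _ _; exact: rho_inj.
  rewrite undup_id ?iota_uniq// aE.
  by rewrite -(big_mkord xpredT (fun k => a (rho k) *: e (rho k))) /index_iota subn0.
have cardG : #|` G| = m.
  by rewrite card_imfset //= undup_id ?iota_uniq// size_iota.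
(* The smallest of the [m] entries picked by the greedy algorithm. *)
pose t := `|a (rho m.-1)|.
have rho_le k l : (k <= l)%N -> `|a (rho l)| <= `|a (rho k)|.
  elim: l => [|l IH]; first by rewrite leqn0 => /eqP->.
  rewrite leq_eqVlt => /predU1P[->//|]; rewrite ltnS => /IH.
  exact: le_trans.
have G_ge i : i \in G -> t <= `|a i|.
  case/imfsetP => k /=; rewrite mem_iota add0n => km ->.
  by apply: rho_le; rewrite -ltnS prednK.
have G_le i : i \notin G -> `|a i| <= t.
  move=> iG; apply: rho_max => k; rewrite -ltnS prednK// => km irho.
  move/negP: iG; apply; apply/imfsetP; exists k => //=.
  by rewrite mem_iota.
have t0 : 0 <= t by exact: normr_ge0.
pose y := x - proj (A `|` G)%fset x.
have yE i : coef y i = if i \in (A `|` G)%fset then 0 else a i.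
  by rewrite coef_cproj aE.
have zE i : coef z i = a i - (if i \in A then b i else 0).
  by rewrite coefficientB aE coef_sum ?fset_uniq.
have cardAG : (#|` (A `\` G)%fset| <= #|` (G `\` A)%fset|)%N.
  by rewrite !cardfsD fsetIC leq_sub2r// cardG.
apply: greedy_norm_le => j D bD.
have [B' [B'B cardB' bB']] := most (G `\` A)%fset.
pose Y := `|y - proj D y| + \sum_(i <- D) `|coef y i|.
have Y0 : 0 <= Y by rewrite addr_ge0// sumr_ge0.
have upper : partial_l1 j D (x - proj G x) <=
    (1 + d) ^- j * (Y + t * #|` (G `\` A)%fset|%:R).
  apply: (@le_trans _ _ (partial_l1 j D (y + proj (A `\` G)%fset x))).
    apply: partial_l1_mono => i; rewrite (coefficientD y) coef_proj yE coef_cproj aE !inE.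
    by case: (i \in A); case: (i \in G); rewrite /= ?addr0 ?add0r.
  apply: le_trans (partial_l1D _ _ _ _) _; rewrite mulrDr lerD2l.
  apply: le_trans (partial_l1_sum _ _ _ _) _; rewrite ler_pM2l//.
  apply: (@le_trans _ _ (\sum_(i <- (A `\` G)%fset) t)).
    rewrite big_seq [leRHS]big_seq; apply: ler_sum => i.
    by rewrite !inE aE => /andP[/G_le].
  by rewrite big_const_seq count_predT iter_addr_0 -[leLHS]mulr_natr ler_wpM2l// ler_nat.
have lower : (1 + d) ^- j.+1 * (Y + t * #|` B'|%:R) <= greedy_norm z.
  have bDB : l1_bounded (j.+1%:R * C) (D `|` B')%fset.
    by rewrite -natr1 mulrDl mul1r; exact: l1_boundedU.
  apply: le_trans (greedy_norm_ub z bDB); rewrite ler_pM2l// -addrA; apply: lerD.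
    apply: coef_norm_le => i; rewrite !coef_cproj zE aE !inE.
    case: (i \in D) => //=.
    have := fsubsetP B'B i; rewrite !inE.
    case: (i \in A); case: (i \in G); case: (i \in B') => //=;
      by rewrite ?normr0 ?subr0// => /(_ isT).
  apply: (@le_trans _ _ (\sum_(i <- (D `|` B')%fset)
      (`|coef y i| + (if i \in B' then t else 0)))).
    rewrite big_split; apply: lerD; first by apply: sumr_fset_sub; rewrite ?fsubsetUl.
    apply: (@le_trans _ _ (\sum_(i <- B') (if i \in B' then t else 0))).
      rewrite big_seq (eq_bigr (fun=> t)); last by move=> i ->.
      by rewrite -big_seq big_const_seq count_predT iter_addr_0 mulr_natr.
    apply: sumr_fset_sub; first exact: fsubsetUr.
    by move=> i; case: ifP.
  apply: ler_sum => i _; rewrite yE zE !inE.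
  have := fsubsetP B'B i; rewrite !inE; have := G_ge i.
  case: (i \in A); case: (i \in G); case: (i \in B') => //=;
    rewrite ?normr0 ?add0r ?addr0 ?subr0//;
    by move=> ta Bi; first [exact: ta isT|have := Bi isT].
apply: le_trans upper _.
apply: le_trans (ler_wpM2l (ltW K0) lower).
have -> : (1 + d) / mu * ((1 + d) ^- j.+1 * (Y + t * #|` B'|%:R)) =
   (1 + d) ^- j * ((Y + t * #|` B'|%:R) / mu).
  by rewrite exprS invfM; field; rewrite !gt_eqF ?exprn_gt0 ?addr_gt0.
rewrite ler_pM2l// ler_pdivlMr// mulrDl lerD//; first by rewrite ler_piMr.
by rewrite -mulrA ler_wpM2l// mulrC.
Qed.
End Norm.
End Renorming.

Definition greedy_renormable (R : realType) (X : normedModType R)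
    (e : nat -> X) : Prop :=
  schauder_basis e /\
  forall eps : R, 0 < eps ->
  exists N : X -> R,
    [/\ equivalent_norm N, normalized_for N e, unconditional_for N 1 e
      & greedy_for N (1 + eps) e].

(** With [d = eps / 2], the constant [(1 + d) / mu] equals [1 + eps] for
    [mu = (1 + d) / (1 + eps) < 1], and [k] halving steps exhaust the
    proportion [mu] of a finite set once [2 ^- k <= 1 - mu = d / (1 + eps)]. *)
Theorem greedy_renorming (R : realType) (X : completeNormedModType R)
    (e : nat -> X) (C : R) :
  (forall i, `|e i| = 1) -> finitely_unconditional e -> finite_sums_dense e ->
  0 <= C -> halves_l1 e C ->
  greedy_renormable e.
Proof.
move=> e1 eU dense C0 half; split; first exact: schauder_basis_of_dense.
move=> eps eps0; have [coef coefP] := choice (expands_exists e1 eU dense).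
pose d := eps / 2; have d0 : 0 < d by rewrite divr_gt0.
pose mu := (1 + d) / (1 + eps).
have eps1 : 0 < 1 + eps by lra.
have mu0 : 0 < mu by rewrite divr_gt0// /d; lra.
have mu1 : mu <= 1 by rewrite ler_pdivrMr// mul1r /d; lra.
have [k kP] : exists k : nat, (1 + eps) / d <= (2 ^ k)%:R.
  exists (Num.bound ((1 + eps) / d)).
  apply: le_trans (ltW (archi_boundP _)) _; first by rewrite ltW// divr_gt0.
  by rewrite ler_nat ltnW// ltn_expl.
have kC0 : 0 <= k%:R * C by rewrite mulr_ge0.
exists (greedy_norm e coef (k%:R * C) d); split.
- exact: equivalent_greedy_norm.
- exact: normalized_greedy_norm.
- exact: unconditional_greedy_norm.
have -> : 1 + eps = (1 + d) / mu.
  by rewrite /mu; field; rewrite !gt_eqF// addr_gt0.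
apply: greedy_greedy_norm => // B.
have [B' [B'B cardB' bB']] := l1_bounded_most e1 eU coefP k B C0 half.
exists B'; split => //.
move: cardB'; rewrite cardfsDS// -(ler_nat R) natrM natrB ?fsubset_leq_card//.
set b := #|` B|%:R; set b' := #|` B'|%:R => cardB'.
have b0 : 0 <= b by rewrite ler0n.
have b'b : b' <= b by rewrite ler_nat fsubset_leq_card.
have : (1 + eps) * (b - b') <= d * b.
  rewrite -ler_pdivrMl// mulrA [_^-1 * _]mulrC; apply: le_trans cardB'.
  by rewrite ler_wpM2r// subr_ge0.
move=> h; rewrite /mu mulrAC ler_pdivrMr//; move: h; rewrite /d; lra.
Qed.

(** * Completions *)

Lemma completion_sum (R : realType) (V : lmodType R) (S : set V) (N : V -> R)
    (X : completeNormedModType R) (j : V -> X) (v : nat -> V) :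
  is_completion S N j -> S 0 ->
  (forall c u w, S u -> S w -> S (c *: u + w)) -> (forall i, S (v i)) ->
  forall (r : seq nat) (a : nat -> R),
    S (\sum_(i <- r) a i *: v i) /\
    j (\sum_(i <- r) a i *: v i) = \sum_(i <- r) a i *: j (v i).
Proof.
move=> [jlin _ _] S0 Slin Sv r a.
have j0 : j 0 = 0.
  have := jlin 1 0 0 S0 S0; rewrite !scale1r addr0 => /eqP.
  by rewrite -subr_eq0 opprD addrA subrr sub0r oppr_eq0 => /eqP.
elim: r => [|i r [IS IH]]; first by rewrite !big_nil.
by rewrite !big_cons; split; [exact: Slin|rewrite jlin// IH].
Qed.

Lemma completion_dense (R : realType) (V : lmodType R) (S : set V)
    (N : V -> R) (X : completeNormedModType R) (j : V -> X) (v : nat -> V) :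
  is_completion S N j -> S 0 ->
  (forall c u w, S u -> S w -> S (c *: u + w)) -> (forall i, S (v i)) ->
  (forall u, S u -> exists (r : seq nat) (a : nat -> R),
     uniq r /\ u = \sum_(i <- r) a i *: v i) ->
  finite_sums_dense (fun i => j (v i)).
Proof.
move=> Sj S0 Slin Sv span x d d0.
have [_ _ dense] := Sj.
have : closure (j @` S) x by rewrite dense.
move=> /(_ (ball x d) (nbhsx_ballx x d d0)) [_ [[u Su <-]]].
rewrite -ball_normE /= => xu.
have [r [a [ur uE]]] := span u Su; exists r, a; split=> //.
by have [_ <-] := completion_sum Sj S0 Slin Sv r a; rewrite -uE.
Qed.

(** * Tsirelson's space *)

Section TsirelsonNorm.
Context (R : realType) (N : (nat -> R) -> R) (HN : is_tsirelson_norm N).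

Lemma c00_fset (D : {fset nat}) (x : nat -> R) :
  (forall i, i \notin D -> x i = 0) -> c00 R x.
Proof.
move=> xD; apply: (@sub_finite_set _ _ [set` D]) => [i /= xi|]; last first.
  exact: finite_fset.
by apply: contraT => /xD x0; rewrite x0 eqxx in xi.
Qed.

Lemma fset_c00 (x : nat -> R) : c00 R x ->
  exists D : {fset nat}, forall i, i \notin D -> x i = 0.
Proof.
move=> /finite_fsetP[D xD]; exists D => i iD; apply/eqP; apply: contraNT iD => xi.
by have : [set` D] i by rewrite -xD.
Qed.

Lemma c00_0 : c00 R 0.
Proof. by apply: (@c00_fset fset0). Qed.

Lemma c00_lin c (u w : nat -> R) : c00 R u -> c00 R w -> c00 R (c *: u + w).
Proof.
move=> /fset_c00[D uD] /fset_c00[F wF]; apply: (@c00_fset (D `|` F)%fset) => i.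
rewrite !inE negb_or => /andP[/uD ui /wF wi].
by rewrite -[LHS]/(c * u i + w i) ui wi mulr0 addr0.
Qed.

Lemma c00_unit_vector i : c00 R (unit_vector R i).
Proof.
apply: (@c00_fset [fset i]%fset) => k; rewrite inE => /negPf ki.
by rewrite /unit_vector ki.
Qed.

Lemma sum_unit_vector (r : seq nat) (a : nat -> R) k : uniq r ->
  (\sum_(i <- r) a i *: unit_vector R i) k = if k \in r then a k else 0.
Proof.
move=> ur; rewrite fct_sumE (eq_bigr (fun i => a i * (i == k)%:R)); last first.
  by move=> i _; rewrite eq_sym.
case: ifPn => kr.
  rewrite (bigD1_seq k)//= eqxx mulr1 big1 ?addr0// => i /negPf->.
  by rewrite mulr0.
rewrite big_seq big1// => i ir; rewrite (_ : i == k = false) ?mulr0//.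
by apply: contraNF kr => /eqP<-.
Qed.

Lemma tsirelson_coord x i : c00 R x -> `|x i| <= N x.
Proof.
move=> cx; rewrite -lee_fin HN.2// le_max; apply/orP; left.
by apply: ereal_sup_ubound; exists i.
Qed.

Lemma tsirelson_ge0 x : c00 R x -> 0 <= N x.
Proof. by move=> cx; exact: le_trans (tsirelson_coord 0%N cx). Qed.

Lemma tsirelson_admissible x n E : c00 R x -> admissible n E ->
  \sum_(i < n) N (restriction (E i) x) <= 2 * N x.
Proof.
move=> cx adm; rewrite -ler_pdivrMl// -lee_fin [leRHS]HN.2// le_max.
apply/orP; right; rewrite EFinM lee_wpmul2l ?lee_fin//.
by apply: ereal_sup_ubound; exists n, E.
Qed.

Lemma tsirelson_le x M : c00 R x -> (forall i, `|x i| <= M) ->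
  (forall n E, admissible n E ->
     \sum_(i < n) N (restriction (E i) x) <= 2 * M) ->
  N x <= M.
Proof.
move=> cx xM admM; rewrite -lee_fin HN.2// ge_max; apply/andP; split.
  by apply: ge_ereal_sup => _ [i _ <-]; rewrite lee_fin.
have -> : M%:E = ((2^-1)%:E * (2 * M)%:E)%E.
  by rewrite -EFinM mulrA mulVf// mul1r.
rewrite lee_wpmul2l ?lee_fin//.
by apply: ge_ereal_sup => _ [n [E [adm ->]]]; rewrite lee_fin admM.
Qed.

Lemma tsirelsonZ c x : c00 R x -> N (c *: x) = `|c| * N x.
Proof. by move=> cx; have [[_ NZ _] _] := HN; exact: NZ. Qed.

Lemma tsirelson0 : N 0 = 0.
Proof.
rewrite -(scale0r (0 : nat -> R)) tsirelsonZ ?normr0 ?mul0r//; exact: c00_0.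
Qed.

Lemma admissible_before n E i k : admissible n E -> (i < k < n)%N ->
  set_before (E i) (E k).
Proof.
move=> [n0 fin next _]; elim: k => [|k IH]; first by rewrite ltn0.
rewrite ltnS leq_eqVlt => /andP[/predU1P[->|ik] kn]; first exact: next.
move=> p q Ep Eq; have [_ [s Es]] := fin k (ltnW kn).
apply: (@ltn_trans s); first by apply: IH => //; rewrite ik ltnW.
exact: (next k).
Qed.

(** When one block contains the support of [x], the admissible sum is [N x]
    itself and, after halving, contributes nothing to the maximum that
    defines [N x].  This breaks the circularity of the implicit equation. *)
Lemma tsirelson_one_block x n E l : c00 R x -> admissible n E -> (l < n)%N ->
  (forall i, x i != 0 -> E l i) ->
  \sum_(i < n) N (restriction (E i) x) = N x.
Proof.
move=> cx adm ln xE; rewrite (bigD1 (Ordinal ln))//= big1 ?addr0.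
  congr N; apply/funext => i; rewrite /restriction; case: ifPn => // iE.
  apply/esym/eqP; apply: contraNT iE => /xE ?; exact/mem_set.
move=> i il; rewrite -[RHS]tsirelson0; congr N; apply/funext => k.
rewrite /restriction; case: ifPn => // /set_mem Eik.
apply/eqP; apply: contraT => /xE Elk.
have : (i < l)%N || (l < i)%N by rewrite -neq_ltn; exact: il.
case/orP => h.
  have := @admissible_before n E i l adm; rewrite h ln => /(_ isT k k Eik Elk).
  by rewrite ltnn.
have := @admissible_before n E l i adm; rewrite h ltn_ord => /(_ isT k k Elk Eik).
by rewrite ltnn.
Qed.

(** Induction on the size of the support: an admissible family either has one
    block that contains the support or cuts it into strictly smaller pieces. *)
Lemma tsirelson_mono x y : c00 R y -> (forall i, `|x i| <= `|y i|) -> N x <= N y.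
Proof.
move=> /fset_c00[D]; have [m] := ubnP #|` D|.
elim: m => // m IH in D x y *; rewrite ltnS => Dm yD xy.
have xD i : i \notin D -> x i = 0.
  by move=> iD; apply/eqP; rewrite -normr_le0 (le_trans (xy i))// yD// normr0.
have cx := c00_fset xD; have cy := c00_fset yD.
(* If the second term is the larger one, then [N x <= 0]. *)
suff : N x <= Num.max (N y) (N x / 2).
  rewrite le_max => /orP[//|]; have := tsirelson_ge0 cx; have := tsirelson_ge0 cy.
  lra.
apply: tsirelson_le => // [i|n E adm].
  by rewrite le_max (le_trans (xy i))// tsirelson_coord.
have [[l [ln lE]]|noblock] :=
    pselect (exists l, (l < n)%N /\ forall i, i \in D -> E l i).
  rewrite (tsirelson_one_block cx adm ln) => [|i xi].
    by rewrite maxr_pMr// le_max; apply/orP; right; rewrite mulrC divfK.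
  by apply: lE; apply: contraT => /xD x0; rewrite x0 eqxx in xi.
apply: (@le_trans _ _ (2 * N y)); last by rewrite ler_wpM2l// le_max lexx.
apply: le_trans (tsirelson_admissible cy adm); apply: ler_sum => l _.
have [p pD pE] : exists2 p, p \in D & ~ E l p.
  apply: contrapT => h; apply: noblock; exists l; split=> // i iD.
  by apply: contrapT => iE; apply: h; exists i.
apply: (IH (D `\ p)%fset).
- by move: Dm; rewrite (cardfsD1 p) pD.
- move=> i; rewrite !inE negb_and negbK /restriction => /orP[/eqP->|/yD->].
    by case: ifPn => // /set_mem.
  by rewrite if_same.
- by move=> i; rewrite /restriction; case: ifP; rewrite ?normr0.
Qed.

Lemma tsirelson_unit_vector i : N (unit_vector R i) = 1.
Proof.
have cu := c00_unit_vector i.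
apply/le_anti/andP; split; last first.
  by apply: le_trans (tsirelson_coord i cu); rewrite /unit_vector eqxx normr1.
suff : N (unit_vector R i) <= Num.max 1 (N (unit_vector R i) / 2).
  by rewrite le_max => /orP[//|]; lra.
apply: tsirelson_le => // [k|n E adm].
  rewrite le_max /unit_vector.
  by case: (k == i); rewrite ?normr1 ?normr0 ?lexx ?ler01.
have [[l [ln lE]]|noblock] := pselect (exists l, (l < n)%N /\ E l i).
  rewrite (tsirelson_one_block cu adm ln) => [|k].
    by rewrite maxr_pMr// le_max; apply/orP; right; rewrite mulrC divfK.
  by rewrite /unit_vector; case: (eqVneq k i) => [->//|]; rewrite eqxx.
rewrite big1 => [|l _]; first by rewrite mulr_ge0// le_max ler01.
rewrite -[RHS]tsirelson0; congr N; apply/funext => k.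
rewrite /restriction; case: ifPn => // /set_mem Elk.
rewrite /unit_vector; case: eqVneq => // ki.
by case: noblock; exists l; split=> //; rewrite -ki.
Qed.

(** The upper half of a set of [n] coordinates consists of at most
    [n./2.+1] coordinates, all of them at least [n./2] counting from 0, so that
    its singletons form an admissible family. *)
Lemma tsirelson_halves (B : {fset nat}) : exists B' : {fset nat},
  [/\ (B' `<=` B)%fset, (#|` B| <= 2 * #|` B'|)%N &
    forall a : nat -> R, \sum_(i <- B') `|a i| <=
      2 * N (\sum_(i <- B') a i *: unit_vector R i)].
Proof.
pose s := sort leq B; have s_size : size s = #|` B| by rewrite size_sort.
have s_sorted : sorted ltn s.
  by rewrite ltn_sorted_uniq_leq sort_uniq fset_uniq sort_sorted//; exact: leq_total.
have s_nth k : (k < size s)%N -> (k <= nth 0%N s k)%N.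
  elim: k => // k IH ks; apply: leq_ltn_trans (IH (ltnW ks)) _.
  by apply: (sorted_ltn_nth ltn_trans) => //; rewrite inE// ltnW.
pose h := (size s)./2; pose u := drop h s.
have u_uniq : uniq u by rewrite drop_uniq// sort_uniq fset_uniq.
have u_size : (size s <= 2 * size u)%N.
  by rewrite size_drop /h mul2n -{1}(odd_double_half (size s)); lia.
have h_size : (size u <= h.+1)%N.
  by rewrite size_drop /h -{1}(odd_double_half (size s)); case: odd; lia.
have u_nth k : (k < size u)%N -> nth 0%N u k = nth 0%N s (h + k) by rewrite nth_drop.
have hk k : (k < size u)%N -> (h + k < size s)%N by rewrite size_drop; lia.
exists [fset i in u]%fset; split.
- apply/fsubsetP => i; rewrite !inE => /mem_drop; by rewrite mem_sort.
- by rewrite card_fseq undup_id// -s_size.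
have u_perm : perm_eq [fset i in u]%fset u.
  by apply: uniq_perm => // i; rewrite inE.
move=> a; rewrite !(perm_big u u_perm)/=.
set x := \sum_(i <- u) _ *: _.
have cx : c00 R x.
  apply: (@c00_fset [fset i in u]%fset) => i; rewrite inE /x sum_unit_vector//.
  by move=> /negPf->.
have [u0|u0] := posnP (size u).
  by rewrite (size0nil u0) big_nil mulr_ge0// tsirelson_ge0.
pose E l := [set nth 0%N u l].
have adm : admissible (size u) E.
  split=> //.
  - by move=> i _; split; [exact: finite_set1|exists (nth 0%N u i)].
  - move=> i iu p q -> ->; rewrite !u_nth ?(ltnW iu)//.
    by apply: (sorted_ltn_nth ltn_trans) => //; rewrite ?inE ?hk ?(ltnW iu)// ltn_add2l.
  - move=> i ->; apply: leq_trans h_size _; rewrite ltnS u_nth// addn0.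
    by apply: s_nth; rewrite -(addn0 h) hk.
apply: le_trans (tsirelson_admissible cx adm).
rewrite (big_nth 0%N) big_mkord; apply: ler_sum => l _.
have -> : restriction (E l) x = a (nth 0%N u l) *: unit_vector R (nth 0%N u l).
  apply/funext => k; rewrite /restriction -[RHS]/(a _ * (k == _)%:R).
  have [->|kl] := eqVneq k (nth 0%N u l).
    by rewrite mem_set// /x sum_unit_vector// mem_nth// mulr1.
  by rewrite mulr0 memNset//; exact/eqP.
by rewrite tsirelsonZ ?tsirelson_unit_vector ?mulr1//; exact: c00_unit_vector.
Qed.

End TsirelsonNorm.

Theorem tsirelson_greedy (R : realType) (N : (nat -> R) -> R)
    (T : completeNormedModType R) (j : (nat -> R) -> T) :
  is_tsirelson_norm N -> is_completion (c00 R) N j ->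
  greedy_renormable (fun i => j (unit_vector R i)).
Proof.
move=> HN Hj; set e := fun i => _; have [_ jN _] := Hj.
have sumE r a : `|\sum_(i <- r) a i *: e i| =
    N (\sum_(i <- r) a i *: unit_vector R i).
  have [cs <-] := completion_sum Hj (@c00_0 R) (@c00_lin R)
    (@c00_unit_vector R) r a.
  exact: jN.
have c00_sum (r : seq nat) (a : nat -> R) :
    c00 R (\sum_(i <- r) a i *: unit_vector R i).
  by have [] := completion_sum Hj (@c00_0 R) (@c00_lin R)
    (@c00_unit_vector R) r a.
apply: (@greedy_renorming _ _ _ 2) => //.
- by move=> i; rewrite jN ?tsirelson_unit_vector//; exact: c00_unit_vector.
- move=> r a b ur ab; rewrite !sumE; apply: tsirelson_mono => // i.
  by rewrite !sum_unit_vector//; case: ifP.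
- apply: (completion_dense Hj) => //.
  + exact: c00_0.
  + exact: c00_lin.
  + exact: c00_unit_vector.
  move=> u /fset_c00[D uD]; exists D, u; rewrite fset_uniq; split=> //.
  apply/funext => k; rewrite sum_unit_vector ?fset_uniq//.
  by case: ifPn => // /uD.
- move=> B; have [B' [B'B cardB' bB']] := tsirelson_halves HN B.
  by exists B'; split => // a; rewrite sumE.
Qed.

(** * Dyadic intervals *)

Lemma seq_argmin (R : realDomainType) (T : eqType) (f : T -> R) (s : seq T) :
  s != [::] ->
  exists2 x, x \in s & forall y, y \in s -> f x <= f y.
Proof.
elim: s => // x s IH _; have [->|/IH[y ys ymin]] := eqVneq s [::].
  by exists x; rewrite ?mem_head// => y; rewrite inE => /eqP->.
have [xy|yx] := leP (f x) (f y).
  exists x; rewrite ?mem_head// => z; rewrite inE => /predU1P[->//|/ymin].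
  exact: le_trans.
exists y; rewrite ?inE ?ys ?orbT// => z; rewrite inE => /predU1P[->|/ymin//].
exact: ltW.
Qed.

Definition parent (I : int * int) : int * int := (I.1 + 1, (I.2 %/ 2)%Z).

(** Inclusion of dyadic intervals, in a form that makes two intervals with a
    common subinterval comparable by construction. *)
Definition below (K I : int * int) : Prop := exists d, iter d parent K = I.

Definition midpoint (R : realType) (I : int * int) : R :=
  (2 * I.2 + 1)%:~R * 2 ^ (I.1 - 1).
Arguments midpoint : clear implicits.

Lemma parent_left I : parent (left_half I) = I.
Proof.
case: I => n k; rewrite /parent /left_half /= subrK; congr pair; lia.
Qed.

Lemma parent_right I : parent (right_half I) = I.
Proof.
case: I => n k; rewrite /parent /right_half /= subrK; congr pair; lia.
Qed.

Lemma below_trans J I K : below I J -> below J K -> below I K.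
Proof. by move=> [d <-] [d' <-]; exists (d' + d)%N; rewrite iterD. Qed.

Lemma below_left I : below (left_half I) I.
Proof. by exists 1%N; rewrite /= parent_left. Qed.

Lemma below_right I : below (right_half I) I.
Proof. by exists 1%N; rewrite /= parent_right. Qed.

Lemma iter_parent1 d I : (iter d parent I).1 = I.1 + d%:Z.
Proof. by elim: d => [|d IH]; rewrite ?addr0//= IH -addrA -PoszD addn1. Qed.

Lemma below_proper I J K : below K I -> below K (right_half J) -> I <> J ->
  (I.1 <= J.1) -> below I (right_half J).
Proof.
move=> [d dI] [d' dJ] IJ lvl.
have d1 := iter_parent1 d K; rewrite dI in d1.
have d2 := iter_parent1 d' K; rewrite dJ /right_half /= in d2.
have dd : (d <= d'.+1)%N by lia.
move: dd; rewrite leq_eqVlt => /predU1P[dE|dlt].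
  by case: IJ; rewrite -dI dE /= dJ parent_right.
exists (d' - d)%N; rewrite -dI -iterD subnK//; lia.
Qed.

Section Dyadic.
Context (R : realType).

Let p2 (n : int) : 0 < (2 ^ n : R).
Proof. by rewrite exprz_gt0. Qed.

Let p2S (n : int) : 2 ^ (n + 1) = 2 * 2 ^ n :> R.
Proof. by rewrite expfzDr// expr1z mulrC. Qed.

Let p2P (n : int) : 2 ^ n = 2 * 2 ^ (n - 1) :> R.
Proof. by rewrite -p2S subrK. Qed.

Lemma dyadic_parent I : dyadic R I `<=` dyadic R (parent I).
Proof.
case: I => n k x; rewrite /dyadic /parent /= p2S => /andP[kx xk].
have := p2 n; set t := 2 ^ n in kx xk * => t0.
have lo : (2 * (k %/ 2)%Z)%:~R <= k%:~R :> R by rewrite ler_int; lia.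
have hi : (k + 1)%:~R <= (2 * ((k %/ 2)%Z + 1))%:~R :> R by rewrite ler_int; lia.
rewrite !intrM in lo hi; apply/andP; split.
  by apply: le_trans kx; rewrite mulrA ler_pM2r// mulrC.
by apply: lt_le_trans xk _; rewrite mulrA ler_pM2r// [leRHS]mulrC.
Qed.

Lemma dyadic_below K I : below K I -> dyadic R K `<=` dyadic R I.
Proof.
move=> [d <-]; elim: d => //= d IH x Kx; exact/dyadic_parent/IH.
Qed.

Lemma dyadic_level_eq I J x : dyadic R I x -> dyadic R J x -> I.1 = J.1 -> I = J.
Proof.
case: I J => n k [m l]; rewrite /dyadic /= => /andP[kx xk] /andP[lx xl] nm.
subst m; congr pair; have t0 := p2 n.
have := le_lt_trans kx xl; have := le_lt_trans lx xk.
rewrite !ltr_pM2r// !ltr_int; lia.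
Qed.

Lemma dyadic_meet I J x : dyadic R I x -> dyadic R J x -> I.1 <= J.1 ->
  below I J.
Proof.
move=> Ix Jx IJ; exists `|J.1 - I.1|%N.
apply: (@dyadic_level_eq _ _ x) => //; last by rewrite iter_parent1; lia.
by apply: dyadic_below Ix; eexists.
Qed.

Lemma dyadic_midpoint I : dyadic R I (midpoint R I).
Proof.
case: I => n k; rewrite /dyadic /midpoint /= (p2P n).
set t := 2 ^ (n - 1); have t0 : 0 < t by exact: p2.
rewrite !mulrA !ler_pM2r// !ltr_pM2r// -[2 : R]/(2%:~R) -!intrM ler_int ltr_int; lia.
Qed.

Lemma midpoint_left K J : below K (left_half J) -> midpoint R K < midpoint R J.
Proof.
move=> KJ; have := dyadic_below KJ (dyadic_midpoint K).
by rewrite /dyadic /left_half /= => /andP[_].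
Qed.

Lemma midpoint_right K I : below K (right_half I) -> midpoint R I < midpoint R K.
Proof.
move=> KI; have : dyadic R (right_half I) (K.2%:~R * 2 ^ K.1).
  apply: (dyadic_below KI); rewrite /dyadic /= lexx ltr_pM2r// ltr_int; lia.
rewrite /dyadic /right_half /= => /andP[h _]; apply: le_lt_trans h _.
rewrite /midpoint [2 ^ K.1]p2P mulrA ltr_pM2r//.
rewrite -[2 : R]/(2%:~R) -!intrM ltr_int; lia.
Qed.

Lemma dyadic_halves I x : dyadic R I x ->
  dyadic R (left_half I) x \/ dyadic R (right_half I) x.
Proof.
case: I => n k; rewrite /dyadic /left_half /right_half /= (p2P n).
set t := 2 ^ (n - 1) => /andP[kx xk].
have [h|h] := ltP x ((2 * k + 1)%:~R * t); [left|right]; apply/andP; split => //.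
  by rewrite intrM [2%:~R * _]mulrC -mulrA.
by rewrite -addrA -[1 + 1]/(2 * 1 : int) -mulrDr intrM [2%:~R * _]mulrC -mulrA.
Qed.

(** The two halves carry the values [1] and [-1] times [2 ^- I.1], so the
    square is constant on the interval. *)
Lemma haar_sqr I x :
  haar R I x ^+ 2 = ((2 ^ I.1)^-1 * \1_(dyadic R I) x) ^+ 2.
Proof.
rewrite /haar !indicE.
have [Ix|Ix] := pselect (dyadic R I x); last first.
  rewrite !memNset// => [|h|h].
  - by rewrite subrr.
  - by apply: Ix; apply: dyadic_below h; exact: below_right.
  - by apply: Ix; apply: dyadic_below h; exact: below_left.
rewrite (mem_set Ix).
have LR : dyadic R (left_half I) x -> ~ dyadic R (right_half I) x.
  move=> l r; have := dyadic_level_eq l r erefl; rewrite /left_half /right_half.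
  by case=> /eqP; rewrite -subr_eq0; lia.
case: (dyadic_halves Ix) => h.
  by rewrite mem_set// memNset ?subr0//; exact: LR.
rewrite (mem_set h) memNset ?sub0r ?mulrN ?sqrrN//.
by move=> l; exact: (LR l).
Qed.

Lemma measurable_dyadic I : measurable (dyadic R I).
Proof.
rewrite (_ : dyadic R I = `[I.2%:~R * 2 ^ I.1, (I.2 + 1)%:~R * 2 ^ I.1[%classic)//.
Qed.

Lemma lebesgue_dyadic I : lebesgue_measure (dyadic R I) = (2 ^ I.1)%:E.
Proof.
rewrite (_ : dyadic R I = `[I.2%:~R * 2 ^ I.1, (I.2 + 1)%:~R * 2 ^ I.1[%classic).
  rewrite lebesgue_measure_itv /= lte_fin ltr_pM2r// ltr_int ltrDl ltr01.
  by rewrite -EFinB -mulrBl -intrB addrAC subrr add0r mul1r.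
by apply/seteqP; split => x; rewrite /dyadic /= in_itv.
Qed.

Lemma integral_dyadic I :
  (\int[lebesgue_measure]_x (\1_(dyadic R I) x)%:E)%E = (2 ^ I.1 : R)%:E.
Proof.
rewrite integral_indic ?setIT//; first exact: lebesgue_dyadic.
exact: measurable_dyadic.
Qed.

Definition free_of (F : {fset int * int}) (J : int * int) : Prop :=
  forall K, K \in F -> ~ below K J.

Definition half_free (F : {fset int * int}) (I : int * int) : bool :=
  `[< free_of F (left_half I) \/ free_of F (right_half I) >].

(** Send an interval [I] of [F], both halves of which contain members of [F],
    to the member of [F] in its right half whose midpoint is leftmost; this is
    the successor of [I] in the in-order traversal of the binary tree of dyadic
    intervals.  Its left half contains no member of [F], since the midpoint of
    such a member would be further left.  The map is injective: if [I] and a larger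
    [I'] had the same image [J], then [I] would lie in the right half of [I'],
    and its midpoint is to the left of that of [J].  Hence at least half of
    the intervals have a half that contains no member of [F]. *)
Lemma card_half_free (F : {fset int * int}) :
  (#|` F| <= 2 * #|` [fset I in F | half_free F I]%fset|)%N.
Proof.
set good := [fset I in F | _]%fset.
pose bad : {fset int * int} := [fset I in F | ~~ half_free F I]%fset.
have next_ex I : exists J, I \in bad -> [/\ J \in F, below J (right_half I) &
    forall K, K \in F -> below K (right_half I) -> midpoint R J <= midpoint R K].
  have [Ib|] := boolP (I \in bad); last by exists I.
  have [K KF KI] : exists2 K, K \in F & below K (right_half I).
    apply: contrapT => noK; move: Ib; rewrite !inE => /andP[_] /asboolPn; apply.
    by right => K KF KI; apply: noK; exists K.
  pose s := [seq K <- F | `[< below K (right_half I) >]].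
  have Ks : K \in s by rewrite mem_filter KF andbT; exact/asboolP.
  have [|J] := @seq_argmin _ _ (midpoint R) s; first by case: (s) Ks.
  rewrite mem_filter => /andP[/asboolP JI JF] Jmin; exists J => _; split=> //.
  by move=> L LF LI; apply: Jmin; rewrite mem_filter LF andbT; exact/asboolP.
have [next nextP] := choice next_ex.
have next_good I : I \in bad -> next I \in good.
  move=> /nextP[JF JI Jmin]; rewrite !inE /= JF; apply/asboolP; left => K KF KJ.
  have KI : below K (right_half I).
    by apply: below_trans JI; apply: below_trans KJ (below_left _).
  by have := Jmin K KF KI; rewrite leNgt (midpoint_left KJ).
have next_lt I I' : I \in bad -> I' \in bad -> I.1 <= I'.1 ->
    next I = next I' -> I = I'.
  move=> Ib Ib' lvl JE; apply: contrapT => II'.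
  have [JF JI _] := nextP _ Ib; have [_ JI' Jmin] := nextP _ Ib'.
  rewrite -JE in JI' Jmin.
  have IF : I \in F by move: Ib; rewrite !inE => /andP[].
  have II : below I (right_half I').
    by apply: (below_proper (below_trans JI (below_right _)) JI').
  by have := Jmin I IF II; rewrite leNgt (midpoint_right JI).
have next_inj : {in bad &, injective next}.
  move=> I I' Ib Ib' JE; have [lvl|/ltW lvl] := leP I.1 I'.1.
    exact: next_lt.
  exact/esym/next_lt.
have bad_le : (#|` bad| <= #|` good|)%N.
  rewrite -(card_in_imfset imfset_key (p := mem bad) next_inj).
  apply: fsubset_leq_card; apply/fsubsetP => _ /imfsetP[I Ib ->]; exact: next_good.
have -> : #|` F| = (#|` good| + #|` bad|)%N.
  rewrite -(cardfsID good F); congr (_ + _)%N; congr #|` _|; apply/fsetP => I;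
    by rewrite !inE; case: (I \in F); case: (half_free F I).
by rewrite mul2n -addnn leq_add2l.
Qed.

(** * Dyadic Hardy space *)

Definition square_function (r : seq nat) (phi : nat -> int * int)
    (a : nat -> R) (x : R) : R :=
  Num.sqrt (\sum_(i <- r) a i ^+ 2 * haar R (phi i) x ^+ 2).

Lemma measurable_square_function r phi a :
  measurable_fun [set: R] (fun x => (square_function r phi a x)%:E).
Proof.
apply/measurable_EFinP; apply: measurableT_comp.
  by apply: continuous_measurable_fun; exact: sqrt_continuous.
apply: measurable_sum => i; apply: measurable_funM; first exact: measurable_cst.
apply: measurable_funX; apply: measurable_funM; first exact: measurable_cst.
by apply: measurable_funB; apply: measurable_indic; exact: measurable_dyadic.
Qed.

Definition empty_half (F : {fset int * int}) (I : int * int) : int * int :=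
  if `[< free_of F (left_half I) >] then left_half I else right_half I.

Lemma empty_halfP F I : half_free F I -> free_of F (empty_half F I).
Proof.
move=> /asboolP hF; rewrite /empty_half; case: asboolP => // nl.
by case: hF.
Qed.

Lemma empty_half_level F I : (empty_half F I).1 = I.1 - 1.
Proof. by rewrite /empty_half; case: asboolP. Qed.

Lemma empty_half_sub F I : dyadic R (empty_half F I) `<=` dyadic R I.
Proof.
apply: dyadic_below; rewrite /empty_half; case: asboolP => _.
  exact: below_left.
exact: below_right.
Qed.

(** If the interval [I] is smaller than [J] and meets the half chosen in [J],
    then it lies in that half, which contains no member of [F]. *)
Lemma empty_half_disjoint F I J x : I \in F -> J \in F ->
  half_free F I -> half_free F J ->
  dyadic R (empty_half F I) x -> dyadic R (empty_half F J) x -> I = J.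
Proof.
wlog lvl : I J / I.1 <= J.1 => [wl IF JF fI fJ Ix Jx|IF JF fI fJ Ix Jx].
  by have [h|/ltW h] := leP I.1 J.1; [exact: wl|exact/esym/wl].
have [lvlE|lvl'] : I.1 = J.1 \/ I.1 <= J.1 - 1 by lia.
  exact: dyadic_level_eq (empty_half_sub Ix) (empty_half_sub Jx) lvlE.
have := empty_halfP fJ IF; case.
apply: (dyadic_meet (empty_half_sub Ix) Jx); by rewrite empty_half_level.
Qed.

(** As the chosen halves are disjoint, at most one term on the left is nonzero
    at [x], and it is at most the corresponding term of the square function. *)
Lemma square_function_ge (r : seq nat) (phi : nat -> int * int) (a : nat -> R)
    (F : {fset int * int}) x : injective phi -> uniq r ->
  (forall i, i \in r -> phi i \in F /\ half_free F (phi i)) ->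
  \sum_(i <- r) `|a i| * (2 ^ (phi i).1)^-1 *
     \1_(dyadic R (empty_half F (phi i))) x <= square_function r phi a x.
Proof.
move=> phi_inj ur rF.
have [[i [ir ix]]|noi] := pselect (exists i, i \in r /\
    dyadic R (empty_half F (phi i)) x); last first.
  rewrite big_seq big1 ?sqrtr_ge0// => i ir.
  by rewrite indicE memNset ?mulr0// => ix; apply: noi; exists i.
rewrite (bigD1_seq i)//= big_seq_cond big1 ?addr0; last first.
  move=> k /andP[kr ki]; rewrite indicE memNset ?mulr0// => kx.
  have [iF fi] := rF i ir; have [kF fk] := rF k kr.
  by move: ki; rewrite (phi_inj _ _ (empty_half_disjoint kF iF fk fi kx ix)) eqxx.
rewrite /square_function (bigD1_seq i)//=.
have -> : `|a i| * (2 ^ (phi i).1)^-1 * \1_(dyadic R (empty_half F (phi i))) x =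
    Num.sqrt (a i ^+ 2 * haar R (phi i) x ^+ 2).
  rewrite haar_sqr !indicE !mem_set//; last exact: empty_half_sub ix.
  have w0 : 0 <= (2 ^ (phi i).1)^-1 :> R by rewrite invr_ge0 ltW.
  by rewrite !mulr1 -exprMn sqrtr_sqr normrM (ger0_norm w0).
rewrite ler_wsqrtr// lerDl sumr_ge0// => k _.
by rewrite mulr_ge0// sqr_ge0.
Qed.

End Dyadic.

Section HardyNorm.
Context (R : realType) (phi : nat -> int * int) (phi_bij : bijective phi).

Let phi_inj : injective phi := bij_inj phi_bij.

Lemma haar_span_0 : haar_span R 0.
Proof.
exists fset0, (fun=> 0); apply/funext => x.
by rewrite /haar_sum big_seq_fset0.
Qed.

Lemma haar_span_lin c (u w : R -> R) :
  haar_span R u -> haar_span R w -> haar_span R (c *: u + w).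
Proof.
move=> [F [a ->]] [G [b ->]].
exists (F `|` G)%fset, (fun I => c * (if I \in F then a I else 0) +
  (if I \in G then b I else 0)).
apply/funext => x; rewrite -[LHS]/(c * haar_sum F a x + haar_sum G b x).
have ext (A B : {fset int * int}) b' : (A `<=` B)%fset ->
    haar_sum A b' x = \sum_(I <- B) (if I \in A then b' I else 0) * haar R I x.
  move=> AB; rewrite -(big_fset_incl _ AB); last first.
    by move=> I _ /negPf->; rewrite mul0r.
  by rewrite /haar_sum big_seq [RHS]big_seq; apply: eq_bigr => I ->.
rewrite (ext _ _ _ (fsubsetUl F G)) (ext _ _ _ (fsubsetUr F G)).
rewrite mulr_sumr -big_split/=.
by apply: eq_bigr => I _; rewrite mulrDl mulrA.
Qed.

Lemma haar_span_haar I : haar_span R (haar R I).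
Proof.
exists [fset I]%fset, (fun=> 1); apply/funext => x.
by rewrite /haar_sum big_seq_fset1 mul1r.
Qed.

Lemma haar_sumE (r : seq nat) (a : nat -> R) : uniq r ->
  exists (F : {fset int * int}) (b : int * int -> R),
  \sum_(i <- r) a i *: haar R (phi i) = haar_sum F b /\
  forall x, \sum_(I <- F) b I ^+ 2 * haar R I x ^+ 2 =
    \sum_(i <- r) a i ^+ 2 * haar R (phi i) x ^+ 2.
Proof.
move=> ur; have [psi phiK psiK] := phi_bij.
exists [fset phi i | i in r]%fset, (a \o psi); split => [|x].
  apply/funext => x; rewrite /haar_sum fct_sumE big_imfset/=; last first.
    by move=> ? ? _ _; exact: phi_inj.
  by rewrite undup_id//; apply: eq_bigr => i _; rewrite phiK.
rewrite big_imfset/=; last by move=> ? ? _ _; exact: phi_inj.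
by rewrite undup_id//; apply: eq_bigr => i _; rewrite phiK.
Qed.

Lemma haar_span_sum u : haar_span R u -> exists (r : seq nat) (a : nat -> R),
  uniq r /\ u = \sum_(i <- r) a i *: haar R (phi i).
Proof.
have [psi phiK psiK] := phi_bij; move=> [F [a ->]].
exists [seq psi K | K <- F], (a \o phi); split.
  by rewrite map_inj_uniq ?fset_uniq//; exact: can_inj psiK.
apply/funext => x; rewrite /haar_sum fct_sumE big_map; apply: eq_bigr => I _.
by rewrite /= psiK.
Qed.

Context (N : (R -> R) -> R) (HN : is_hardy_norm N).

Lemma hardy_normE (r : seq nat) (a : nat -> R) : uniq r ->
  (N (\sum_(i <- r) a i *: haar R (phi i)))%:E =
  (\int[lebesgue_measure]_x (square_function r phi a x)%:E)%E.
Proof.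
move=> ur; have [F [b [-> Fb]]] := haar_sumE a ur; rewrite HN.
by apply: eq_integral => x _; rewrite Fb.
Qed.

Lemma hardy_norm_mono (r : seq nat) (a b : nat -> R) : uniq r ->
  (forall i, `|a i| <= `|b i|) ->
  N (\sum_(i <- r) a i *: haar R (phi i)) <=
  N (\sum_(i <- r) b i *: haar R (phi i)).
Proof.
move=> ur ab; rewrite -lee_fin !hardy_normE//.
apply: ge0_le_integral => //; try exact: measurable_square_function.
- by move=> x _; rewrite lee_fin sqrtr_ge0.
move=> x _; rewrite lee_fin ler_wsqrtr//; apply: ler_sum => i _.
rewrite ler_wpM2r ?sqr_ge0// -[leLHS]real_normK ?num_real//.
by rewrite -[leRHS]real_normK ?num_real// lerXn2r// nnegrE.
Qed.

Lemma hardy_norm_haar I : N (haar R I) = 1.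
Proof.
have := HN [fset I]%fset (fun=> 1).
have -> : haar_sum [fset I]%fset (fun=> 1) = haar R I.
  by apply/funext => x; rewrite /haar_sum big_seq_fset1 mul1r.
under eq_integral => x _.
  rewrite big_seq_fset1 expr1n mul1r haar_sqr sqrtr_sqr ger0_norm; last first.
    by rewrite mulr_ge0// invr_ge0 exprz_ge0.
  rewrite EFinM; over.
have p0 : 0 < (2 ^ I.1 : R) by rewrite exprz_gt0.
have mI := @measurable_dyadic R I.
have m1 : measurable_fun [set: R] (fun x => (\1_(dyadic R I) x : R)%:E).
  by apply/measurable_EFinP; exact: measurable_indic.
rewrite ge0_integralZl_EFin//; last by rewrite invr_ge0 ltW.
rewrite integral_dyadic -EFinM mulVf ?gt_eqF//.
by case.
Qed.

(** Each chosen half has half the measure of its interval, so the integral of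
    the pointwise lower bound is half of the l1 norm. *)
Lemma hardy_l1_lower (r : seq nat) (a : nat -> R) (F : {fset int * int}) :
  uniq r ->
  (forall i, i \in r -> phi i \in F /\ half_free F (phi i)) ->
  \sum_(i <- r) `|a i| <= 2 * N (\sum_(i <- r) a i *: haar R (phi i)).
Proof.
move=> ur rF; rewrite -ler_pdivrMl// -lee_fin hardy_normE//.
have p0 n : 0 < (2 ^ n : R) by rewrite exprz_gt0.
have mE i : measurable (dyadic R (empty_half F (phi i))) by exact: measurable_dyadic.
pose g i x := ((`|a i| * (2 ^ (phi i).1)^-1)%:E *
  (\1_(dyadic R (empty_half F (phi i))) x)%:E)%E.
have mg i : measurable_fun [set: R] (g i).
  apply: emeasurable_funM; first exact: measurable_cst.
  by apply/measurable_EFinP; exact: measurable_indic.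
have g0 i x : (0 <= g i x)%E.
  by rewrite /g -EFinM lee_fin !mulr_ge0// invr_ge0 ltW.
have -> : ((2^-1 * \sum_(i <- r) `|a i|)%:E =
    \int[lebesgue_measure]_x (\sum_(i <- r) g i x))%E.
  rewrite ge0_integral_sum// mulr_sumr -sumEFin; apply: eq_bigr => i _.
  have m1 : measurable_fun [set: R]
      (fun x => (\1_(dyadic R (empty_half F (phi i))) x : R)%:E).
    by apply/measurable_EFinP; exact: measurable_indic.
  rewrite ge0_integralZl_EFin//; last by rewrite mulr_ge0// invr_ge0 ltW.
  rewrite integral_dyadic empty_half_level -EFinM.
  congr EFin; have -> : 2 ^ (phi i).1 = 2 * 2 ^ ((phi i).1 - 1) :> R.
    by rewrite -[in LHS](subrK 1 (phi i).1) expfzDr// expr1z mulrC.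
  by rewrite invfM -!mulrA mulVf ?gt_eqF// mulr1 mulrC.
apply: ge0_le_integral => //.
- by move=> x _; exact: sume_ge0.
- exact: emeasurable_sum.
- exact: measurable_square_function.
move=> x _; rewrite /g; under eq_bigr do rewrite -EFinM.
by rewrite sumEFin lee_fin; exact: square_function_ge.
Qed.

Lemma hardy_halves (B : {fset nat}) : exists B' : {fset nat},
  [/\ (B' `<=` B)%fset, (#|` B| <= 2 * #|` B'|)%N &
    forall a : nat -> R, \sum_(i <- B') `|a i| <=
      2 * N (\sum_(i <- B') a i *: haar R (phi i))].
Proof.
pose F : {fset int * int} := [fset phi i | i in B]%fset.
exists [fset i in B | half_free F (phi i)]%fset; split.
- by apply/fsubsetP => i; rewrite !inE => /andP[].
- have := card_half_free R F.
  have -> : [fset I in F | half_free F I]%fset =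
      [fset phi i | i in [fset i in B | half_free F (phi i)]%fset]%fset.
    apply/fsetP => I; rewrite !inE; apply/andP/imfsetP => /=.
      by case=> /imfsetP[i /= iB ->] h; exists i; rewrite // !inE iB.
    case=> i; rewrite !inE => /andP[iB h] ->; split; last exact/asboolP.
    by apply/imfsetP; exists i.
  by rewrite /F !(card_imfset _ _ phi_inj).
move=> a; apply: (@hardy_l1_lower _ _ F); first exact: fset_uniq.
move=> i; rewrite !inE /= => /andP[iB h]; split; last exact/asboolP.
by apply/imfsetP; exists i.
Qed.
End HardyNorm.

Theorem hardy_greedy (R : realType) (N : (R -> R) -> R)
    (H1 : completeNormedModType R) (j : (R -> R) -> H1) (phi : nat -> int * int) :
  is_hardy_norm N -> is_completion (haar_span R) N j -> bijective phi ->
  greedy_renormable (fun i => j (haar R (phi i))).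
Proof.
move=> HN Hj phi_bij; set e := fun i => _; have [_ jN _] := Hj.
have span_e i : haar_span R (haar R (phi i)) by exact: haar_span_haar.
have sumE r a : `|\sum_(i <- r) a i *: e i| =
    N (\sum_(i <- r) a i *: haar R (phi i)).
  have [cs <-] := completion_sum Hj (@haar_span_0 R) (@haar_span_lin R) span_e r a.
  exact: jN.
apply: (@greedy_renorming _ _ _ 2) => //.
- by move=> i; rewrite jN ?hardy_norm_haar.
- by move=> r a b ur ab; rewrite !sumE; exact: hardy_norm_mono.
- apply: (completion_dense Hj) => //.
  + exact: haar_span_0.
  + exact: haar_span_lin.
  + exact: haar_span_sum.
- move=> B; have [B' [B'B cardB' bB']] := hardy_halves phi_bij HN B.
  by exists B'; split => // a; rewrite sumE.
Qed.

Theorem corollary12 (R : realType) :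
  (forall (NH : (R -> R) -> R) (H1 : completeNormedModType R)
          (j : (R -> R) -> H1) (phi : nat -> int * int),
     is_hardy_norm NH ->
     is_completion (haar_span R) NH j ->
     bijective phi ->
     let e := fun i => j (haar R (phi i)) in
     schauder_basis e /\
     forall eps : R, 0 < eps ->
     exists N : H1 -> R,
       [/\ equivalent_norm N,
           normalized_for N e,
           unconditional_for N 1 e
         & greedy_for N (1 + eps) e])
  /\
  (forall (NT : (nat -> R) -> R) (T : completeNormedModType R)
          (j : (nat -> R) -> T),
     is_tsirelson_norm NT ->
     is_completion (c00 R) NT j ->
     let e := fun i => j (unit_vector R i) in
     schauder_basis e /\
     forall eps : R, 0 < eps ->
     exists N : T -> R,
       [/\ equivalent_norm N,
           normalized_for N e,
           unconditional_for N 1 e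
         & greedy_for N (1 + eps) e]).
Proof.
split=> [NH H1 j phi HNH Hj phi_bij|NT T j HNT Hj].
- exact: hardy_greedy Hj phi_bij.
- exact: tsirelson_greedy HNT Hj.
Qed.
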